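(* Let $q$ be a prime power, let $n$ be a positive integer, and let $(d_1,\ldots,d_\ell)\in\mathbb{N}^\ell\cup\{(0,\ldots,0)\}$ be a symmetric Ferrers sequence. If $r=\partial(d_1,\ldots,d_\ell)$ is even, then $$q^{|\Xi\cap(d_1,\ldots,d_\ell)|}\,W_r(\mathrm{Alt}_q^{n\times n}[d_1,\ldots,d_\ell])=W_r(\mathrm{Sym}_q^{n\times n}[d_1,\ldots,d_\ell]).$$
   Context: A Ferrers diagram is a finite set $\mathcal{F}\subseteq\mathbb{N}\times\mathbb{N}$ ($\mathbb{N}$ the positive integers; $(i,j)$ = row $i$, column $j$) such that $(i,j)\in\mathcal{F}$ implies $(s,t)\in\mathcal{F}$ for all $1\le s\le i$, $1\le t\le j$; it is symmetric if $(i,j)\in\mathcal{F}$ implies $(j,i)\in\mathcal{F}$. The $i$-th diagonal is $\Delta_i=\{(s,i-s+1):1\le s\le i\}$ and $\Xi=\{(i,i):i\in\mathbb{N}\}$. A sequence $(d_1,\ldots,d_\ell)$ of non-negative integers is a Ferrers sequence if it is all zero or there is $r\in\{1,\ldots,\ell\}$ with $d_i=i$ for $i\le r$ and $d_r\ge\cdots\ge d_\ell$; it is a symmetric Ferrers sequence if moreover there exists $r\in\{1,\ldots,\ell\}$ such that $d_i$ is even whenever $i\in\{1,\ldots,r\}$ is even or $i\in\{r+1,\ldots,\ell\}$; such sequences are the diagonal sequences $(|\Delta_i\cap\mathcal{F}|)_{i\le\ell}$ of symmetric Ferrers diagrams $\mathcal{F}$ with no cells on diagonals beyond $\ell$. $\partial(d_1,\ldots,d_\ell)=\max_i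 d_i$ (the maximum size of a non-attacking rook placement, i.e. of a set of cells no two in the same row or column, in such an $\mathcal{F}$). A matrix over $\mathbb{F}_q$ is symmetric if $M_{ij}=M_{ji}$, alternating if $M_{ii}=0$ and $M_{ij}=-M_{ji}$. $W_r(\mathrm{Sym}_q^{n\times n}[d_1,\ldots,d_\ell])$ (resp. $W_r(\mathrm{Alt}_q^{n\times n}[d_1,\ldots,d_\ell])$) denotes the number of symmetric (resp. alternating) $n\times n$ matrices over $\mathbb{F}_q$ of rank $r$ with support $\{(i,j):M_{ij}\neq0\}$ contained in a symmetric Ferrers diagram $\mathcal{F}\subseteq\{1,\ldots,n\}^2$ with $|\Delta_i\cap\mathcal{F}|=d_i$ for $i\le\ell$ and $|\Delta_i\cap\mathcal{F}|=0$ for $i>\ell$ (the paper takes these numbers to depend only on the sequence). $|\Xi\cap(d_1,\ldots,d_\ell)|=|\Xi\cap\mathcal{F}|$, which equals the number of indices $i$ with $d_i$ odd. *)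

(* Defs.v *)
From mathcomp Require Import all_boot all_order all_algebra.

Set Implicit Arguments.
Unset Strict Implicit.
Unset Printing Implicit Defensive.

Import GRing.Theory.
Local Open Scope ring_scope.

Section FerrersSequences.

Local Open Scope nat_scope.

(* A sequence (d_1, ..., d_l) is a [seq nat]; [term d i] is d_i, with i
   starting at 1. *)
Definition term (d : seq nat) (i : nat) : nat := nth 0 d i.-1.

Definition ferrers_seq (d : seq nat) : Prop :=
  (forall i, 1 <= i <= size d -> term d i = 0) \/
  (exists r, [/\ 1 <= r <= size d,
     forall i, 1 <= i <= r -> term d i = i &
     forall i, r <= i < size d -> term d i.+1 <= term d i]).

Definition sym_ferrers_seq (d : seq nat) : Prop :=
  ferrers_seq d /\
  exists r, 1 <= r <= size d /\
    forall i, (1 <= i <= r /\ ~~ odd i) \/ (r.+1 <= i <= size d) ->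
      ~~ odd (term d i).

Definition maxdiag (d : seq nat) : nat := \max_(x <- d) x.

End FerrersSequences.

Section FerrersDiagrams.

Local Open Scope nat_scope.

Variable n : nat.

(* The cell in row i and column j of {1, ..., n}^2 is the pair of ordinals
   (i - 1, j - 1). *)
Implicit Type D : {set 'I_n * 'I_n}.

Definition ferrers_diagram D : Prop :=
  forall i j s t : 'I_n, (i, j) \in D -> s <= i -> t <= j -> (s, t) \in D.

Definition sym_diagram D : Prop :=
  forall i j : 'I_n, (i, j) \in D -> (j, i) \in D.

(* Cells of the i-th diagonal have 1-based coordinates with sum i + 1. *)
Definition diagonal (i : nat) : {set 'I_n * 'I_n} :=
  [set c : 'I_n * 'I_n | c.1.+1 + c.2.+1 == i.+1].

Definition main_diagonal : {set 'I_n * 'I_n} := [set c | c.1 == c.2].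

Definition has_diagonals D (d : seq nat) : Prop :=
  (forall i, 1 <= i <= size d -> #|diagonal i :&: D| = term d i) /\
  (forall i, size d < i -> #|diagonal i :&: D| = 0).

End FerrersDiagrams.

Section Matrices.

Variables (K : finFieldType) (n : nat).
Implicit Types (M : 'M[K]_n) (D : {set 'I_n * 'I_n}).

Definition symmetric_mx M : bool := [forall i, forall j, M i j == M j i].

Definition alternating_mx M : bool :=
  [forall i, M i i == 0] && [forall i, forall j, M i j == - M j i].

Definition support_mx M : {set 'I_n * 'I_n} := [set c | M c.1 c.2 != 0].

Definition W_sym (r : nat) D : nat :=
  #|[set M : 'M[K]_n |
      [&& symmetric_mx M, support_mx M \subset D & \rank M == r]]|.

Definition W_alt (r : nat) D : nat :=
  #|[set M : 'M[K]_n |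
      [&& alternating_mx M, support_mx M \subset D & \rank M == r]]|.

End Matrices.

Arguments W_sym K {n} r D.
Arguments W_alt K {n} r D.

(* Main.v *)
Require Import Defs.
From mathcomp Require Import all_boot all_order all_algebra.
From mathcomp Require Import ring zify.

(* A cell on the first incomplete diagonal bounds the rank of every matrix
   supported on the diagram by [r], and only this bound matters. Restrict to
   cells of [S x S] and induct on [#|S|], fibring over the row [x] of index
   [m = max S]. If [x = 0], drop [m]. If [x <> 0] but [x_m = 0], let [p] be the
   last index of the support of [x] and [y] the row of index [p]; removing the
   rank 2 matrix spanned by [x] and [y] stays inside the diagram and leaves a
   matrix of rank [r - 2] on [S \ {m, p}]. The symmetric case allows [q] times
   as many [y] as the alternating one, namely a free [y_p], and accounts for the
   cell [(p, p)]. If [(m, m)] is not in the diagram these are all the cases. If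
   it is, the diagram contains [S x S], one may assume [r = #|S|], and the fibres
   with [x_m <> 0], present only in the symmetric case, are handled by the closed
   formula for the number of invertible symmetric matrices. *)

Set Implicit Arguments.
Unset Strict Implicit.
Unset Printing Implicit Defensive.

Import Order.TTheory GRing.Theory.

(** * Rank bounds from the support, and one elimination step *)

Section Rank.
Local Open Scope ring_scope.
Variables (K : fieldType) (n : nat).
Implicit Types (M : 'M[K]_n) (A : {set 'I_n}).

Lemma mxrank_rows_leq A M :
  (forall i j, M i j != 0 -> i \in A) -> (\rank M <= #|A|)%N.
Proof.
move=> MA; have sub : (M <= \sum_(i in A) <<row i M>>)%MS.
  apply/row_subP => i; have [iA|iNA] := boolP (i \in A).
    by apply: (sumsmx_sup i) => //; rewrite genmxE.
  suff -> : row i M = 0 by rewrite sub0mx.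
  by apply/rowP => j; rewrite !mxE; apply: contraNeq iNA => /MA.
apply: (leq_trans (mxrankS sub)).
apply: (leq_trans (mxrank_sum_leqif _)) => /=.
rewrite -sum1_card; apply: leq_sum => i _.
by rewrite genmxE rank_leq_row.
Qed.

(** Splitting off the rows in [A] leaves a matrix whose nonzero columns all lie in [B], and the rank
    is subadditive. *)
Lemma mxrank_cross_leq A (B : {set 'I_n}) M :
  (forall i j, M i j != 0 -> (i \in A) || (j \in B)) ->
  (\rank M <= #|A| + #|B|)%N.
Proof.
move=> MAB; pose MA : 'M_n := \matrix_(i, j) (if i \in A then M i j else 0).
have -> : M = MA + (M - MA) by rewrite addrC subrK.
apply: (leq_trans (mxrank_add _ _)); apply: leq_add.
  by apply: mxrank_rows_leq => i j; rewrite mxE; case: ifP => //; rewrite eqxx.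
rewrite -mxrank_tr; apply: mxrank_rows_leq => i j; rewrite !mxE.
by case: ifP => jA; rewrite ?subrr ?eqxx // subr0 => /MAB; rewrite jA.
Qed.

Lemma mxrank_diag_set A :
  \rank (\matrix_(i < n, j < n) ((i == j) && (i \in A))%:R : 'M[K]_n) = #|A|.
Proof.
have up (B : {set 'I_n}) :
    (\rank (\matrix_(i < n, j < n) ((i == j) && (i \in B))%:R : 'M[K]_n)
       <= #|B|)%N.
  by apply: mxrank_rows_leq => i j; rewrite mxE; case: (i \in B) => //;
    rewrite andbF eqxx.
(* For the lower bound, the identity is the sum of the diagonal matrices of [A] and of its
   complement, so [n] is at most the sum of their ranks. *)
apply/eqP; rewrite eqn_leq up /= -(leq_add2r #|~: A|) cardsC card_ord.
rewrite -[X in (X <= _)%N](mxrank1 K n).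
apply: (@leq_trans _ _ _ _ (leq_add (leqnn _) (up (~: A)))).
apply: leq_trans (mxrank_add _ _); rewrite leq_eqVlt; apply/orP; left.
apply/eqP; congr mxrank; apply/matrixP => i j; rewrite !mxE !inE.
by case: (i == j); case: (i \in A); rewrite ?addr0 ?add0r.
Qed.

(** Clearing column [j0] with row [i0] costs exactly one in rank: the remainder has zero column
    [j0], so its row space meets the line of row [i0] only in 0. *)
Lemma mxrank_pivot M i0 j0 : M i0 j0 != 0 ->
  \rank M = (\rank (\matrix_(i, j) (M i j - M i j0 * M i0 j / M i0 j0)
               : 'M_n)).+1.
Proof.
move=> nz; set M' := (\matrix_(i, j) _).
have defM : M = M' + (M i0 j0)^-1 *: (col j0 M *m row i0 M).
  apply/matrixP => i j; rewrite !mxE big_ord1 !mxE; field.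
  by rewrite nz.
have subM : (M' <= M)%MS.
  rewrite (_ : M' = M - (M i0 j0)^-1 *: (col j0 M *m row i0 M)).
    by rewrite addmx_sub ?eqmx_opp ?scalemx_sub // mulmx_sub // row_sub.
  by apply/eqP; rewrite eq_sym subr_eq; apply/eqP.
have eqM : (M :=: row i0 M + M')%MS.
  apply/eqmxP/andP; split; last by rewrite addsmx_sub row_sub.
  rewrite {1}defM addmx_sub ?addsmxSr // scalemx_sub // mulmx_sub //.
  exact: addsmxSl.
have cap : (row i0 M :&: M' = 0)%MS.
  apply/eqP/rowV0P => v; rewrite sub_capmx => /andP[/sub_rVP[a ->]].
  case/submxP=> w /rowP/(_ j0); rewrite !mxE big1 => [/eqP|i _].
    by rewrite mulf_eq0 (negPf nz) orbF => /eqP->; rewrite scale0r.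
  by rewrite mxE mulfK // subrr mulr0.
rewrite eqM mxrank_disjoint_sum // rank_rV.
suff -> : row i0 M != 0 by [].
by apply: contraNneq nz => /rowP/(_ j0); rewrite !mxE => ->.
Qed.

End Rank.

(** * Rank 2 matrices with two prescribed rows *)

Section Hyperbolic.
Local Open Scope ring_scope.
Variables (K : fieldType) (n : nat).
Implicit Types (x y : 'rV[K]_n) (M : 'M[K]_n).

(* The matrix of rank 2 with rows [x], [y] and columns [s x], [s y] at the
   indices [m], [p], when [x_m = 0], [y_m = s x_p] and [s y_p = y_p]. *)
Definition hyperbolic (s : K) (p : 'I_n) x y : 'M[K]_n :=
  \matrix_(i, j) ((s * y 0 i * x 0 j + x 0 i * y 0 j) / x 0 p
                  - x 0 i * x 0 j * y 0 p / x 0 p ^+ 2).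

Variables (s : K) (p m : 'I_n) (x y : 'rV[K]_n).
Hypotheses (ss : s * s = 1) (xp : x 0 p != 0) (xm : x 0 m = 0).
Hypotheses (ym : y 0 m = s * x 0 p) (yp : s * y 0 p = y 0 p).

Let U := hyperbolic s p x y.

Lemma hyperbolic_row_m j : U m j = x 0 j.
Proof.
rewrite mxE ym xm mulrA ss; field.
by rewrite xp.
Qed.

Lemma hyperbolic_col_m i : U i m = s * x 0 i.
Proof.
rewrite mxE ym xm; field.
by rewrite xp.
Qed.

Lemma hyperbolic_row_p j : U p j = y 0 j.
Proof.
rewrite mxE yp; field.
by rewrite xp.
Qed.

Lemma hyperbolic_col_p i : U i p = s * y 0 i.
Proof.
rewrite mxE; field.
by rewrite xp.
Qed.

(** Two eliminations, with pivots [(m, p)] and then [(p, m)], remove [U] and leave exactly [M]. *)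
Lemma mxrank_hyperbolic M :
    (forall i, [/\ M i p = 0, M i m = 0, M p i = 0 & M m i = 0]) ->
  \rank (U + M)%R = (\rank M).+2.
Proof.
move=> M0; have s0 : s != 0.
  by apply/negP => /eqP s0; move: ss; rewrite s0 mul0r => /esym/eqP;
    rewrite oner_eq0.
set N := U + M.
have Nmj j : N m j = x 0 j.
  by have [_ _ _ E] := M0 j; rewrite mxE hyperbolic_row_m E addr0.
have Npj j : N p j = y 0 j.
  by have [_ _ E _] := M0 j; rewrite mxE hyperbolic_row_p E addr0.
have Nim i : N i m = s * x 0 i.
  by have [_ E _ _] := M0 i; rewrite mxE hyperbolic_col_m E addr0.
have Nip i : N i p = s * y 0 i.
  by have [E _ _ _] := M0 i; rewrite mxE hyperbolic_col_p E addr0.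
rewrite (@mxrank_pivot _ _ N m p) ?Nmj //; set N1 := (\matrix_(i, j) _).
have N1E i j : N1 i j = N i j - s * y 0 i * x 0 j / x 0 p.
  by rewrite mxE Nip !Nmj.
have N1im i : N1 i m = s * x 0 i by rewrite N1E Nim xm; ring.
have N1pj j : N1 p j = y 0 j - y 0 p * x 0 j / x 0 p by rewrite N1E Npj yp.
rewrite (@mxrank_pivot _ _ N1 p m) ?N1im ?mulf_neq0 //.
congr (\rank _).+2; apply/matrixP => i j; rewrite mxE !N1im N1pj N1E.
rewrite !mxE; field.
by rewrite xp s0.
Qed.

End Hyperbolic.

(** * Symmetric and alternating matrices on a diagram, fibred over a row *)

Section Fibers.
Local Open Scope ring_scope.
Variables (K : finFieldType) (n : nat) (e : rel 'I_n).
Hypothesis e_sym : symmetric e.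
Hypothesis e_down : forall i j s t : 'I_n,
  e i j -> (s <= i)%N -> (t <= j)%N -> e s t.
Implicit Types (b : bool) (M : 'M[K]_n) (S : {set 'I_n}) (x y : 'rV[K]_n).

(* [b = true] is the alternating case and [b = false] the symmetric one. *)
Definition signed (b : bool) M : bool :=
  [forall i, forall j, M i j == (-1) ^+ b * M j i]
  && (b ==> [forall i, M i i == 0]).

(** The relation [e] is the diagram and [S] selects a principal submatrix. The ambient size stays
    [n], so that the induction on [S] needs no reindexing. *)
Definition supported S M : bool :=
  [forall i, forall j, (M i j != 0) ==> [&& i \in S, j \in S & e i j]].

Definition signed_rank_set b S r : {set 'M[K]_n} :=
  [set M | [&& signed b M, supported S M & \rank M == r]].

Lemma signedP b M :
  reflect ((forall i j, M i j = (-1) ^+ b * M j i)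
           /\ (b -> forall i, M i i = 0)) (signed b M).
Proof.
apply: (iffP andP) => [] [sM dM]; split.
- by move=> i j; apply/eqP; move/forallP/(_ i)/forallP/(_ j): sM.
- by move=> bT i; apply/eqP; move/implyP/(_ bT)/forallP/(_ i): dM.
- by apply/forallP => i; apply/forallP => j; apply/eqP.
- by apply/implyP => bT; apply/forallP => i; apply/eqP/dM.
Qed.

Lemma supportedP S M :
  reflect (forall i j, M i j != 0 -> [/\ i \in S, j \in S & e i j])
          (supported S M).
Proof.
apply: (iffP forallP) => [sM i j Mij | sM i].
  by move/forallP/(_ j)/implyP/(_ Mij): (sM i) => /and3P[].
by apply/forallP => j; apply/implyP => /sM[-> -> ->].
Qed.

Lemma signedD b M N : signed b M -> signed b N -> signed b (M + N).
Proof.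
move=> /signedP[sM dM] /signedP[sN dN]; apply/signedP; split=> [i j|bT i].
  by rewrite !mxE sM sN mulrDr.
by rewrite mxE dM // dN // addr0.
Qed.

Lemma signedN b M : signed b M -> signed b (- M).
Proof.
move=> /signedP[sM dM]; apply/signedP; split=> [i j|bT i].
  by rewrite !mxE sM mulrN.
by rewrite mxE dM // oppr0.
Qed.

Lemma supportedD S M N :
  supported S M -> supported S N -> supported S (M + N).
Proof.
move=> /supportedP sM /supportedP sN; apply/supportedP => i j.
rewrite mxE; have [Mij|/sM //] := eqVneq (M i j) 0.
by rewrite Mij add0r => /sN.
Qed.

Lemma supportedN S M : supported S M -> supported S (- M).
Proof.
by move=> /supportedP sM; apply/supportedP => i j; rewrite mxE oppr_eq0 => /sM.
Qed.

Lemma supportedS S S' M : S \subset S' -> supported S M -> supported S' M.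
Proof.
move=> /subsetP sSS' /supportedP sM; apply/supportedP => i j /sM[iS jS ->].
by rewrite !sSS'.
Qed.

Lemma supported_rank_leq S M : supported S M -> (\rank M <= #|S|)%N.
Proof. by move/supportedP=> sM; apply: mxrank_rows_leq => i j /sM[]. Qed.

Lemma supportedD1 S m M : supported S M ->
  (forall i, M i m = 0) -> (forall j, M m j = 0) -> supported (S :\ m) M.
Proof.
move=> /supportedP sM cM rM; apply/supportedP => i j nz.
have [iS jS eij] := sM _ _ nz; split=> //; rewrite !inE ?iS ?jS andbT.
  by apply: contraNneq nz => ->; rewrite rM.
by apply: contraNneq nz => ->; rewrite cM.
Qed.

Lemma supported_notin S M i j : supported S M -> 
  (i \notin S) || (j \notin S) -> M i j = 0.
Proof.
by move=> /supportedP sM; apply: contraTeq => /sM[-> ->].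
Qed.

Lemma signedE b M i j : signed b M -> M i j = (-1) ^+ b * M j i.
Proof. by case/signedP. Qed.

Lemma sign_sqr b : (-1) ^+ b * (-1) ^+ b = 1 :> K.
Proof. by case: b; rewrite ?mulr1 // mulrNN mulr1. Qed.

Section TwoRows.
Variables (b : bool) (S : {set 'I_n}) (m p : 'I_n).
Hypotheses (pm : (p < m)%N) (emp : e m p).
Variable x : 'rV[K]_n.
Hypothesis xS : forall j, x 0 j != 0 -> (j \in S) && (j <= p)%N.
Hypothesis xp : x 0 p != 0.

Let S' := S :\ m :\ p.

(** The possible rows of index [p] once row [m] is [x]: symmetry up to sign forces the entry at [m],
    the alternating condition kills the entry at [p], and the diagram restricts the others. *)
Definition second_rows : {set 'rV[K]_n} :=
  [set y : 'rV[K]_n | [&& y 0 m == (-1) ^+ b * x 0 p, b ==> (y 0 p == 0)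
    & [forall j, (y 0 j != 0) ==> ((j \in S) && e p j)]]].

Let xm : x 0 m = 0.
Proof. by apply: contraTeq pm => /xS/andP[_]; rewrite -leqNgt. Qed.

Lemma second_rowsP (y : 'rV[K]_n) : reflect
  [/\ y 0 m = (-1) ^+ b * x 0 p, b -> y 0 p = 0
    & forall j, y 0 j != 0 -> j \in S /\ e p j] (y \in second_rows).
Proof.
rewrite inE; apply: (iffP and3P) => [[/eqP-> yp /forallP yS]|[-> yp yS]].
  split=> // [bT|j nz]; first by apply/eqP; apply: (implyP yp).
  by apply/andP; apply: (implyP (yS j)).
split=> //; first by apply/implyP => bT; apply/eqP/yp.
by apply/forallP => j; apply/implyP => /yS[-> ->].
Qed.

Section Hyp.
Variable y : 'rV[K]_n.
Hypothesis yR : y \in second_rows.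
Let U := hyperbolic ((-1) ^+ b) p x y.

Let ym : y 0 m = (-1) ^+ b * x 0 p.
Proof. by case/second_rowsP: yR. Qed.

Let yp : (-1) ^+ b * y 0 p = y 0 p.
Proof.
case/second_rowsP: yR => _ ypb _; move: ypb; case: (b) => [->//|_].
  by rewrite mulr0.
by rewrite mul1r.
Qed.

Lemma signed_hyperbolic : signed b U.
Proof.
have := yp; case/second_rowsP: yR => _ ypb _.
move: ypb; rewrite /U; case: (b) => [yp0 _|_ _]; apply/signedP.
  by split=> [i j|_ i]; rewrite !mxE yp0 //; field.
by split=> // i j; rewrite !mxE; field.
Qed.

(** Here [p] must be the last index of the support of [x]. A nonzero entry at [(i, j)] has [x_i] or
    [x_j] nonzero, hence an index at most [p]; the cell then lies below [(p, p)] or below a cell of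
    row or column [p] allowed by [y]. *)
Lemma supported_hyperbolic : supported S U.
Proof.
case/second_rowsP: yR => _ _ yS; have epp := e_down emp (ltnW pm) (leqnn p).
apply/supportedP => i j; rewrite mxE.
have [xi0|xi] := eqVneq (x 0 i) 0.
  rewrite xi0 !mul0r subr0 addr0 mulf_eq0 negb_or => /andP[+ _].
  rewrite !mulf_eq0 !negb_or => /andP[/andP[_ /yS[iS epi]] /xS/andP[jS jp]].
  by split=> //; rewrite e_sym in epi; apply: e_down epi _ jp.
have /andP[iS ip] := xS xi.
have [xj0|xj] := eqVneq (x 0 j) 0.
  rewrite xj0 !(mul0r, mulr0) subr0 add0r mulf_eq0 negb_or => /andP[+ _].
  rewrite mulf_eq0 negb_or => /andP[_ /yS[jS epj]].
  by split=> //; apply: e_down epj ip _.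
by have /andP[jS jp] := xS xj; split=> //; apply: e_down epp ip jp.
Qed.

Lemma rank_hyperbolicD M : supported S' M -> \rank (U + M)%R = (\rank M).+2.
Proof.
move=> sM; apply: (@mxrank_hyperbolic _ _ _ _ m) => //; first exact: sign_sqr.
by move=> i; split; apply: (supported_notin sM); rewrite !inE ?eqxx ?andbF ?orbT.
Qed.

Let Um j : U m j = x 0 j.
Proof. exact: (hyperbolic_row_m (sign_sqr b)). Qed.

Let Up j : U p j = y 0 j.
Proof. exact: hyperbolic_row_p. Qed.

(** Translation by [U] is a bijection: [M - U] has zero rows [m] and [p], hence zero columns too,
    and its rank is smaller by 2. The count does not depend on [y]. *)
Lemma card_two_row_fiber r :
  #|[set M in signed_rank_set b S r.+2 | (row m M == x) && (row p M == y)]|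
  = #|signed_rank_set b S' r|.
Proof.
rewrite -[RHS](card_imset _ (addrI U)); apply: eq_card => M; apply/idP/imsetP.
  rewrite !inE => /andP[/and3P[sM suM rM] /andP[/eqP rx /eqP ry]].
  have Mm j : M m j = x 0 j by rewrite -rx mxE.
  have Mp j : M p j = y 0 j by rewrite -ry mxE.
  exists (M - U); last by rewrite addrC subrK.
  have sMU : signed b (M - U).
    by rewrite signedD // signedN // signed_hyperbolic.
  have rm j : (M - U) m j = 0.
    by rewrite mxE [(- U) _ _]mxE Mm Um subrr.
  have rp j : (M - U) p j = 0.
    by rewrite mxE [(- U) _ _]mxE Mp Up subrr.
  have suMU : supported S' (M - U).
    apply: supportedD1 => [|i|//].
      apply: supportedD1 => [|i|//].
        by rewrite supportedD // supportedN // supported_hyperbolic.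
      by rewrite (signedE _ _ sMU) rm mulr0.
    by rewrite (signedE _ _ sMU) rp mulr0.
  rewrite inE sMU suMU /=.
  by have := rank_hyperbolicD suMU; rewrite addrC subrK (eqP rM) => -[->].
case=> M' + ->; rewrite [M' \in _]inE => /and3P[sM suM /eqP rM].
rewrite !inE signedD ?signed_hyperbolic //=.
rewrite rank_hyperbolicD // rM eqxx andbT.
have sS : S' \subset S.
  exact: subset_trans (subD1set _ _) (subD1set _ _).
rewrite supportedD ?supported_hyperbolic ?(supportedS sS) //=.
apply/andP; split; apply/eqP/rowP => j; rewrite [LHS]mxE mxE.
  rewrite Um (supported_notin suM) ?addr0 //.
  by rewrite !inE eqxx ?andbF.
rewrite Up (supported_notin suM) ?addr0 //.
by rewrite !inE eqxx.
Qed.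

End Hyp.

Lemma card_row_fiber r :
  #|[set M in signed_rank_set b S r.+2 | row m M == x]|
  = (#|second_rows| * #|signed_rank_set b S' r|)%N.
Proof.
rewrite -sum1_card (partition_big (fun M => row p M) (mem second_rows)) /=.
  rewrite -sum_nat_const; apply: eq_bigr => y yR.
  rewrite -(card_two_row_fiber yR) -sum1_card; apply: eq_bigl => M.
  by rewrite !inE -!andbA.
move=> M; rewrite !inE => /andP[/and3P[sM /supportedP suM _] /eqP rx].
have Mm j : M m j = x 0 j by rewrite -rx mxE.
apply/and3P; rewrite !mxE (signedE _ _ sM) Mm eqxx; split=> //.
  by apply/implyP => bT; case/signedP: sM => _ ->.
by apply/forallP => j; rewrite mxE; apply/implyP => /suM[_ -> ->].
Qed.

End TwoRows.
End Fibers.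

Lemma sum_mem_card (T : finType) (A : {set T}) : \sum_x (x \in A) = #|A|.
Proof.
by rewrite -sum1_card [RHS]big_mkcond; apply: eq_bigr => x _; case: (x \in A).
Qed.

(** * Rows with prescribed support *)

Section RowCounts.
Local Open Scope ring_scope.
Variables (K : finFieldType) (n : nat).
Implicit Types (m p : 'I_n) (J S : {set 'I_n}) (x y : 'rV[K]_n).

Definition rows_in J : {set 'rV[K]_n} :=
  [set y : 'rV[K]_n | [forall j, (y 0 j != 0) ==> (j \in J)]].

Lemma rows_inP J y :
  reflect (forall j, y 0 j != 0 -> j \in J) (y \in rows_in J).
Proof.
rewrite inE; apply: (iffP forallP) => yJ j; first by apply/implyP.
by apply/implyP; apply: yJ.
Qed.

Lemma card_rows_in J : #|rows_in J| = (#|K| ^ #|J|)%N.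
Proof.
pose f (g : {ffun 'I_n -> K}) : 'rV[K]_n := \row_j g j.
have f_inj : injective f.
  by move=> g h /rowP gh; apply/ffunP => j; have := gh j; rewrite !mxE.
have <- := card_pffun_on (0 : K) (mem J) (mem {: K}).
rewrite -[RHS](card_imset _ f_inj); apply: eq_card => y.
apply/rows_inP/imsetP => [yJ | [g /pffun_onP[/subsetP gJ _] ->] j].
  exists [ffun j => y 0 j]; last by apply/rowP => j; rewrite mxE ffunE.
  apply/pffun_onP; split=> //.
  by apply/subsetP => j; rewrite inE ffunE => /yJ.
by rewrite mxE => gj; apply: gJ; rewrite inE.
Qed.

Lemma card_nonzero_rows_in J : #|rows_in J :\ 0| = (#|K| ^ #|J|).-1%N.
Proof.
have := cardsD1 0 (rows_in J); rewrite card_rows_in.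
suff -> : 0 \in rows_in J by move=> ->.
by apply/rows_inP => j; rewrite mxE eqxx.
Qed.

Lemma rows_inD1 S m x : (x \in rows_in (S :\ m)) =
  (x \in rows_in S) && (x 0 m == 0).
Proof.
apply/rows_inP/andP => [xS|[/rows_inP xS /eqP xm] j nz].
  split; first by apply/rows_inP => j /xS/setD1P[].
  by apply: contraT => /xS; rewrite !inE eqxx.
by rewrite !inE xS // andbT; apply: contraNneq nz => ->; rewrite xm.
Qed.

Lemma pivot_exists S m x : (forall i, i \in S -> (i <= m)%N) ->
    x \in rows_in (S :\ m) -> x != 0 ->
  exists p, [/\ p \in S, (p < m)%N, x 0 p != 0
    & forall j, x 0 j != 0 -> (j \in S) && (j <= p)%N].
Proof.
move=> mmax /rows_inP xS /rV0Pn[i0 xi0].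
case: (@arg_maxnP _ i0 (fun i => x 0 i != 0) val xi0) => p xp pmax; exists p.
have := xS p xp; rewrite !inE => /andP[pm pS].
split=> // [|j xj]; first by rewrite ltn_neqAle mmax // andbT.
by have /setD1P[_ ->] := xS j xj; apply: pmax.
Qed.

End RowCounts.

(** * Sizes of the fibres *)

Section Counts.
Local Open Scope ring_scope.
Variables (K : finFieldType) (n : nat) (e : rel 'I_n).
Hypothesis e_sym : symmetric e.
Hypothesis e_down : forall i j s t : 'I_n,
  e i j -> (s <= i)%N -> (t <= j)%N -> e s t.
Implicit Types (b : bool) (m p : 'I_n) (M : 'M[K]_n) (S : {set 'I_n}) (x y : 'rV[K]_n).

Local Notation X := (@signed_rank_set K n e).

(** The entry at [m] is fixed and the others are free on the allowed cells of row [p]; the summand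
    [~~ b] stands for [y_p], free only in the symmetric case. *)
Lemma card_second_rows b S m p x : m \in S -> p \in S -> (p < m)%N -> e m p ->
  #|second_rows e b S m p x|
    = (#|K| ^ (#|[set j in S | e p j] :\ m :\ p| + ~~ b))%N.
Proof.
move=> mS pS pm emp; have epm : e p m by rewrite e_sym.
have epp := e_down emp (ltnW pm) (leqnn p).
have p_m : p != m by rewrite -val_eqE /= ltn_eqF.
set G := [set j in S | e p j].
pose J := if b then G :\ m :\ p else G :\ m.
have -> : (#|G :\ m :\ p| + ~~ b)%N = #|J|.
  rewrite /J; case: (b) => //=; first by rewrite addn0.
  by rewrite [in RHS](cardsD1 p) !inE p_m pS epp addnC.
rewrite -(card_rows_in K).
(* Translation by [d] carries the forced entry at [m] and reduces the count to rows with support in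
   [J]. *)
pose d : 'rV[K]_n := \row_j ((-1) ^+ b * x 0 p *+ (j == m)).
rewrite -[RHS](card_imset _ (addrI d)); apply: eq_card => y.
apply/second_rowsP/imsetP => [[ym yp yG]|[z /rows_inP zJ ->]].
  exists (y - d); last by rewrite addrC subrK.
  apply/rows_inP => j; rewrite !mxE.
  have [->|jm] := eqVneq j m; first by rewrite ym mulr1n subrr eqxx.
  rewrite subr0 => nz; have [jS epj] := yG _ nz.
  rewrite /J; move: yp; case: (b) => yp; rewrite !inE jm jS epj //= andbT.
  by apply: contraNneq nz => ->; rewrite yp.
have zm : z 0 m = 0.
  apply/eqP; apply: contraT => /zJ; rewrite /J; case: (b);
  by rewrite !inE eqxx ?andbF.
split=> [|bT|j]; rewrite !mxE ?eqxx ?zm ?addr0 //.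
  rewrite (negPf p_m) add0r; apply/eqP; apply: contraT => /zJ.
  by rewrite /J bT !inE eqxx.
have [->|jm] := eqVneq j m; first by [].
rewrite add0r => /zJ; rewrite /J.
by case: (b); rewrite !inE => /andP[_]; [case/andP=> _|]; case/andP.
Qed.

Lemma card_row_partition b S r (m : 'I_n) :
  #|X b S r| = (\sum_x #|[set M in X b S r | row m M == x]|)%N.
Proof.
rewrite -sum1_card (partition_big (fun M => row m M) xpredT) //=.
by apply: eq_bigr => x _; rewrite -sum1_card; apply: eq_bigl => M; rewrite !inE.
Qed.

Lemma card_signed_rank_gt b S r : (#|S| < r)%N -> #|X b S r| = 0%N.
Proof.
move=> ltSr; apply/eqP; rewrite cards_eq0; apply/eqP/setP => M; rewrite !inE.
apply/and3P => -[_ suM /eqP rM]; move: ltSr; rewrite -rM.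
by rewrite ltnNge (supported_rank_leq suM).
Qed.

(** Up to sign, column [m] is row [m], so both vanish together. *)
Lemma zero_row_fiber b S r m :
  [set M in X b S r | row m M == 0] = X b (S :\ m) r.
Proof.
apply/setP => M; rewrite !inE; apply/andP/and3P => [[/and3P[sM suM ->] /eqP/rowP Mm]|].
  have {}Mm j : M m j = 0 by have := Mm j; rewrite !mxE.
  split=> //; apply: supportedD1 => // i.
  by rewrite (signedE _ _ sM) Mm mulr0.
case=> -> suM ->; rewrite (supportedS (subD1set S m)) //; split=> //.
apply/eqP/rowP => j; rewrite !mxE (supported_notin suM) //.
by rewrite !inE eqxx.
Qed.

Lemma row_fiber_support b S r m x :
    (0 < #|[set M in X b S r | row m M == x]|)%N ->
  forall j, x 0 j != 0 -> j \in S /\ e m j.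
Proof.
case/card_gt0P => M; rewrite !inE => /andP[/and3P[_ /supportedP suM _] /eqP<-] j.
by rewrite mxE => /suM[].
Qed.

(* The fibre is a translate by the rank 1 matrix [x^T x / x_m]. *)
Lemma card_diag_row_fiber S r m x : (forall i j, i \in S -> j \in S -> e i j) ->
    x \in rows_in K S -> x 0 m != 0 ->
  #|[set M in X false S r.+1 | row m M == x]| = #|X false (S :\ m) r|.
Proof.
move=> eS /rows_inP xS xm.
pose U : 'M[K]_n := \matrix_(i, j) (x 0 i * x 0 j / x 0 m).
have sU : signed false U.
  by apply/signedP; split=> // i j; rewrite !mxE mul1r [x 0 i * _]mulrC.
have Um j : U m j = x 0 j by rewrite mxE; field.
have suU : supported e S U.
  apply/supportedP => i j; rewrite mxE !mulf_eq0 !negb_or.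
  by case/andP => /andP[/xS iS /xS jS] _; rewrite iS jS eS.
(* Elimination with pivot [(m, m)] turns [M] into [M - U]. *)
have rU M : signed false M -> row m M = x -> \rank M = (\rank (M - U)%R).+1.
  move=> sM /rowP rM; have Mm j : M m j = x 0 j by rewrite -rM mxE.
  have mM i : M i m = x 0 i by rewrite (signedE _ _ sM) mul1r.
  rewrite (@mxrank_pivot _ _ M m m) ?Mm //; congr (\rank _).+1.
  by apply/matrixP => i j; rewrite !mxE mM Mm.
rewrite -[RHS](card_imset _ (addrI U)); apply: eq_card => M; apply/idP/imsetP.
  rewrite !inE => /andP[/and3P[sM suM rM] /eqP rx].
  exists (M - U); last by rewrite addrC subrK.
  have sMU : signed false (M - U) by rewrite signedD // signedN.
  have rm j : (M - U) m j = 0.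
    by rewrite mxE [(- U) _ _]mxE Um -rx mxE subrr.
  rewrite inE sMU -eqSS -rU // rM andbT; apply: supportedD1 => // [|i].
    by rewrite supportedD // supportedN.
  by rewrite (signedE _ _ sMU) rm mulr0.
case=> M' + ->; rewrite [M' \in _]inE => /and3P[sM suM rM].
have rx : row m (U + M') = x.
  apply/rowP => j; rewrite mxE [LHS]mxE Um (supported_notin suM) ?addr0 //.
  by rewrite !inE eqxx.
rewrite !inE rx eqxx andbT signedD // rU ?signedD // (addrC U) addrK eqSS rM andbT.
by rewrite supportedD // (supportedS (subD1set S m)).
Qed.

End Counts.

(** The number of invertible symmetric [k] by [k] matrices over a field with [q] elements: the
    product over [1 <= j <= k] of [q ^ j] for even [j] and [q ^ j - 1] for odd [j]. *)
Fixpoint sym_unit_count (q k : nat) : nat :=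
  if k is k'.+1 then
    (if odd k' then q ^ k else (q ^ k).-1) * sym_unit_count q k'
  else 1.

(** This is the recursion given by the fibres over the last row [x]: the first summand collects the
    nonzero [x] with last entry 0, the second those with last entry nonzero. *)
Lemma sym_unit_countSS q k : 0 < q ->
  sym_unit_count q k.+2 =
    (q ^ k.+1).-1 * (q ^ k.+1 * sym_unit_count q k)
    + (q ^ k.+2 - q ^ k.+1) * sym_unit_count q k.+1.
Proof.
move=> q0 /=; set a := q ^ k.+1; set F := sym_unit_count q k.
have a0 : 0 < a by rewrite expn_gt0 q0.
have -> : q ^ k.+2 = q * a by rewrite expnS.
have le : a <= q * a by rewrite leq_pmull.
case: (odd k) => /=.
  rewrite -mulnDl; congr (_ * _); lia.
rewrite !mulnA -!mulnDl; congr (_ * _).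
rewrite [_.-1 * a]mulnC -mulnDl; congr (_ * _); lia.
Qed.

(** * The induction on the index set *)

Section Induction.
Local Open Scope ring_scope.
Variables (K : finFieldType) (n : nat) (e : rel 'I_n).
Hypothesis e_sym : symmetric e.
Hypothesis e_down : forall i j s t : 'I_n,
  e i j -> (s <= i)%N -> (t <= j)%N -> e s t.
Implicit Types (b : bool) (m p : 'I_n) (M : 'M[K]_n) (S : {set 'I_n})
  (x y : 'rV[K]_n).

Local Notation X := (@signed_rank_set K n e).
Local Notation q := #|K|.

Lemma card_signed_rank_set0 b r : #|X b set0 r| = (r == 0)%N.
Proof.
have -> : X b set0 r = if r == 0%N then [set 0] else set0.
  apply/setP => M; rewrite inE; apply/and3P/idP => [[_ suM /eqP <-]|].
    have -> : M = 0.
      by apply/matrixP => i j; rewrite mxE (supported_notin suM) // inE.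
    by rewrite mxrank0 eqxx inE.
  case: eqP => [->|_]; rewrite !inE // => /eqP->.
  rewrite mxrank0; split=> //; last by apply/supportedP => i j; rewrite mxE eqxx.
  by apply/signedP; split=> [i j|_ i]; rewrite !mxE ?mulr0.
by case: ifP; rewrite ?cards1 ?cards0.
Qed.

Lemma max_elt S : S != set0 ->
  exists2 m : 'I_n, m \in S & forall i, i \in S -> (i <= m)%N.
Proof.
case/set0Pn => i0 Si0; case: (@arg_maxnP _ i0 (mem S) val Si0) => m mS mmax.
by exists m.
Qed.

Lemma card_full_row_fiber b S m p x r :
    (forall i j, i \in S -> j \in S -> e i j) -> m \in S ->
    p \in S -> (p < m)%N -> x 0 p != 0 ->
    (forall j, x 0 j != 0 -> (j \in S) && (j <= p)%N) ->
  #|[set M in X b S r.+2 | row m M == x]|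
    = (q ^ (#|S :\ m :\ p| + ~~ b) * #|X b (S :\ m :\ p) r|)%N.
Proof.
move=> eS mS pS pm xp xS; have emp := eS m p mS pS.
rewrite (card_row_fiber e_sym e_down _ pm emp xS xp).
rewrite (card_second_rows e_sym e_down) //.
suff -> : [set j in S | e p j] = S by [].
by apply/setP => j; rewrite inE; case: (boolP (j \in S)) => // /(eS _ _ pS).
Qed.

Lemma card_sym_full S : (forall i j, i \in S -> j \in S -> e i j) ->
  #|X false S #|S| | = sym_unit_count q #|S|.
Proof.
have [k] := ubnP #|S|; elim: k S => // k IH S leSk eS.
have [->|nS] := eqVneq S set0; first by rewrite card_signed_rank_set0 cards0.
have [m mS mmax] := max_elt nS.
have cS : #|S| = #|S :\ m|.+1 by rewrite (cardsD1 m) mS.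
have eSm i j : i \in S :\ m -> j \in S :\ m -> e i j.
  by move=> /setD1P[_ iS] /setD1P[_ jS]; apply: eS.
pose P := rows_in K (S :\ m) :\ 0; pose Q := rows_in K S :\: rows_in K (S :\ m).
pose k' := #|S :\ m|.
(* The row 0 contributes nothing, since [S :\ m] is too small for rank [#|S|]. The default value of
   [k'.-1] at [k' = 0] is harmless, as [P] is then empty. *)
have fibE x : #|[set M in X false S #|S| | row m M == x]|
    = ((x \in P) * (q ^ k' * sym_unit_count q k'.-1)
       + (x \in Q) * sym_unit_count q k')%N.
  rewrite /P /Q in_setD1 in_setD; have [->|x0] /= := eqVneq x 0.
    rewrite zero_row_fiber // rows_inD1 mxE eqxx andbT andNb.
    by rewrite card_signed_rank_gt // cS.
  have [xSm|xSm] := boolP (x \in rows_in K (S :\ m)).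
    have [p [pS pm xp xS]] := pivot_exists mmax xSm x0.
    have pSm : p \in S :\ m by rewrite !inE pS -val_eqE /= ltn_eqF.
    have cSm : k' = #|S :\ m :\ p|.+1 by rewrite /k' (cardsD1 p) pSm.
    rewrite cS -/k' cSm (card_full_row_fiber _ _ eS mS pS pm xp xS) addn1 IH; first 1 last.
    - by rewrite -ltnS -cSm -ltnS -cS ltnS ltnW.
    - by move=> i j /setD1P[_ iS] /setD1P[_ jS]; apply: eSm.
    - by rewrite /= mul1n mul0n addn0.
  rewrite mul0n add0n; have [xS|xS] /= := boolP (x \in rows_in K S).
    have xm : x 0 m != 0 by move: xSm; rewrite rows_inD1 xS.
    by rewrite cS card_diag_row_fiber // IH ?mul1n // -ltnS -cS ltnS.
  apply/eqP; rewrite mul0n -leqn0 leqNgt; apply: contra xS => nz.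
  by apply/rows_inP => j /(row_fiber_support nz)[].
rewrite (card_row_partition _ _ _ _ _ m) (eq_bigr _ (fun x _ => fibE x)).
rewrite big_split /= -!big_distrl /=.
rewrite !sum_mem_card.
have PE : #|P| = (q ^ k').-1 by apply: card_nonzero_rows_in.
have QE : #|Q| = (q ^ k'.+1 - q ^ k')%N.
  rewrite /Q cardsDS ?card_rows_in -?cS //.
  by apply/subsetP => x; rewrite rows_inD1 => /andP[].
rewrite PE QE cS -/k'; clear; case: k' => [|k'']; first by rewrite !expn0 subn1.
by rewrite [RHS]sym_unit_countSS //; apply/card_gt0P; exists 0.
Qed.

Definition diag_count S := #|[set i in S | e i i]|.

Lemma diag_countD1 S m : m \in S ->
  diag_count S = (e m m + diag_count (S :\ m))%N.
Proof.
move=> mS; rewrite /diag_count (cardsD1 m) inE mS /=; congr (_ + _)%N.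
by apply: eq_card => i; rewrite !inE andbA.
Qed.

Lemma diag_count_full S : (forall i j, i \in S -> j \in S -> e i j) ->
  diag_count S = #|S|.
Proof.
move=> eS; apply: eq_card => i; rewrite inE.
by case: (boolP (i \in S)) => // iS; rewrite eS.
Qed.

(** Adding any hyperbolic matrix to [M] raises the rank by exactly 2 and stays supported on [S], so
    the bound on [S] drops by 2. Some second row [y] exists because the number of them is a power of
    [#|K|]. *)
Lemma second_row_bound S m p x r : m \in S -> p \in S -> (p < m)%N -> e m p ->
    x 0 p != 0 -> (forall j, x 0 j != 0 -> (j \in S) && (j <= p)%N) ->
    (forall M, supported e S M -> (\rank M <= r.+2)%N) ->
  forall M, supported e (S :\ m :\ p) M -> (\rank M <= r)%N.
Proof.
move=> mS pS pm emp xp xS bS M suM.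
have : (0 < #|second_rows e false S m p x|)%N.
  rewrite (card_second_rows e_sym e_down) // expn_gt0.
  by apply/orP; left; apply/card_gt0P; exists 0.
case/card_gt0P => y yR.
have := rank_hyperbolicD pm xS xp yR suM; rewrite -ltnS -[(_ < _)%N]ltnS => <-.
apply: bS; rewrite supportedD ?(supported_hyperbolic e_sym e_down pm emp xS yR) //.
apply: supportedS suM.
exact: subset_trans (subD1set _ _) (subD1set _ _).
Qed.

(** Assuming only a rank bound makes the induction work: the bound passes to [S :\ m] unchanged and
    to [S :\ m :\ p] lowered by 2, which keeps its parity. *)
Lemma card_alt_sym S r : ~~ odd r ->
    (forall M, supported e S M -> (\rank M <= r)%N) ->
  (q ^ diag_count S * #|X true S r| = #|X false S r|)%N.
Proof.
have [k] := ubnP #|S|; elim: k S r => // k IH S r leSk rev bS.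
have [S0|nS] := eqVneq S set0.
  rewrite S0 !card_signed_rank_set0 /diag_count.
  have -> : [set i in set0 | e i i] = set0 by apply/setP => i; rewrite !inE.
  by rewrite cards0 mul1n.
have [m mS mmax] := max_elt nS.
have cS : #|S| = #|S :\ m|.+1 by rewrite (cardsD1 m) mS.
have leSmk : (#|S :\ m| < k)%N by rewrite -ltnS -cS.
have fib_r0 b x : x != 0 -> #|[set M in X b S 0 | row m M == x]| = 0%N.
  move=> x0; apply/eqP; rewrite cards_eq0; apply/eqP/setP => M; rewrite !inE.
  apply/negP => /andP[/and3P[_ _]]; rewrite mxrank_eq0 => /eqP-> /eqP xE.
  by move: x0; rewrite -xE row0 eqxx.
have [emm|emm] := boolP (e m m); last first.
  rewrite !(card_row_partition _ _ _ _ _ m) big_distrr /=; apply: eq_bigr => x _.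
  have [->|x0] := eqVneq x 0.
    rewrite !zero_row_fiber // (diag_countD1 mS) (negPf emm) add0n IH // => M suM.
    by apply: bS; apply: supportedS suM; apply: subD1set.
  have [/forallP xSe|xSe] :=
      boolP [forall j, (x 0 j != 0) ==> ((j \in S) && e m j)]; last first.
    have z b : #|[set M in X b S r | row m M == x]| = 0%N.
      apply/eqP; rewrite -leqn0 leqNgt; apply: contra xSe => nz.
      by apply/forallP => j; apply/implyP => /(row_fiber_support nz)[-> ->].
    by rewrite !z muln0.
  have xSm : x \in rows_in K (S :\ m).
    apply/rows_inP => j xj; have /andP[jS emj] := implyP (xSe j) xj.
    by rewrite !inE jS andbT; apply: contraNneq emm => jm; rewrite -{2}jm.
  have [p [pS pm xp xS]] := pivot_exists mmax xSm x0.
  have /andP[_ emp] := implyP (xSe p) xp.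
  have pSm : p \in S :\ m by rewrite !inE pS -val_eqE /= ltn_eqF.
  (* A matrix of rank 0 has no nonzero row, and parity excludes rank 1. *)
  case: r rev bS => [|[//|r]] rev bS; first by rewrite !fib_r0 // muln0.
  have epp := e_down emp (ltnW pm) (leqnn p).
  rewrite !(card_row_fiber e_sym e_down _ pm emp xS xp).
  (* The extra factor [q] of the symmetric case, from the free [y_p], matches the diagonal cell
     [(p, p)] lost with [p]; [(m, m)] is not a cell. *)
  rewrite !(card_second_rows e_sym e_down) // addn0 addn1.
  rewrite -(IH (S :\ m :\ p) r) ?(diag_countD1 mS) ?(diag_countD1 pSm).
  - by rewrite (negPf emm) epp add0n add1n !expnS; ring.
  - by apply: leq_trans leSmk; rewrite ltnS; apply/subset_leq_card/subD1set.
  - by move: rev; rewrite /= negbK.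
  - exact: (second_row_bound mS pS pm emp xp xS bS).
have eS i j : i \in S -> j \in S -> e i j.
  by move=> iS jS; apply: e_down emm (mmax _ _) (mmax _ _).
(* The diagonal 0-1 matrix of [S] is supported on the diagram and has rank [#|S|]. *)
have leSr : (#|S| <= r)%N.
  rewrite -(mxrank_diag_set K S); apply: bS; apply/supportedP => i j.
  rewrite mxE; have [->|] := eqVneq i j; last by rewrite eqxx.
  by case: (boolP (j \in S)) => [jS _|]; [rewrite eS | rewrite eqxx].
have [ltSr|geSr] := ltnP #|S| r.
  by rewrite !card_signed_rank_gt // muln0.
have rE : r = #|S| by apply/eqP; rewrite eqn_leq leSr geSr.
rewrite {}rE in rev bS fib_r0 *.
rewrite card_sym_full // diag_count_full //.
have [k' cSm] : exists k', #|S :\ m| = k'.+1.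
  by move: rev; rewrite cS; case: #|_| => [//|k' _]; exists k'.
rewrite cS cSm in rev *.
pose P := rows_in K (S :\ m) :\ 0.
have fibE x : #|[set M in X true S k'.+2 | row m M == x]|
    = ((x \in P) * sym_unit_count q k')%N.
  rewrite /P in_setD1; have [->|x0] /= := eqVneq x 0.
    by rewrite zero_row_fiber // card_signed_rank_gt // cSm.
  have [xSm|xSm] := boolP (x \in rows_in K (S :\ m)).
    have [p [pS pm xp xS]] := pivot_exists mmax xSm x0.
    have pSm : p \in S :\ m by rewrite !inE pS -val_eqE /= ltn_eqF.
    have cSp : k' = #|S :\ m :\ p|.
      by apply/eqP; rewrite -eqSS -cSm (cardsD1 p) pSm.
    have eSp i j : i \in S :\ m :\ p -> j \in S :\ m :\ p -> e i j.
      by move=> /setD1P[_ /setD1P[_ iS]] /setD1P[_ /setD1P[_ jS]]; apply: eS.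
    (* The number of second rows, [q ^ #|S :\ m :\ p|], is exactly the factor in the induction
       hypothesis, so the fibre is counted by invertible symmetric matrices. *)
    rewrite (card_full_row_fiber _ _ eS mS pS pm xp xS) addn0 mul1n cSp -card_sym_full // -IH.
    - by rewrite diag_count_full.
    - by rewrite -cSp; lia.
    - by move: rev; rewrite /= negbK -cSp.
    - exact: supported_rank_leq.
  (* An alternating matrix has [x_m = 0], so every row that occurs lies in [rows_in K (S :\ m)]. *)
  apply/eqP; rewrite mul0n cards_eq0; apply: contraNT xSm => /set0Pn[M].
  rewrite !inE => /andP[/and3P[sM /supportedP suM _] /eqP rx].
  have Mm j : x 0 j = M m j by rewrite -rx mxE.
  apply/forallP => j; apply/implyP; rewrite Mm => Mmj; have [_ jS _] := suM _ _ Mmj.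
  rewrite !inE jS andbT; apply: contraNneq Mmj => ->.
  by case/signedP: sM => _ ->.
rewrite (card_row_partition _ _ _ _ _ m) (eq_bigr _ (fun x _ => fibE x)).
rewrite -big_distrl /= sum_mem_card card_nonzero_rows_in cSm.
(* For even [k'], the top two factors of [sym_unit_count] at [k' + 2] are [q ^ (k' + 2)], the
   diagonal factor, and [q ^ (k' + 1) - 1], the number of nonzero rows. *)
by move: rev => /=; rewrite !negbK => /negPf->.
Qed.

End Induction.

(** * The rank bound from an incomplete diagonal *)

Section Diagrams.
Variable n : nat.
Implicit Types (D : {set 'I_n * 'I_n}).

(** For [k < n] the whole diagonal of index [k + 1] lies in the square and has [k + 1] cells. With
    0-based coordinates these cells satisfy [s + t = k]. *)
Lemma partial_diagonal D k : k < n -> #|diagonal n k.+1 :&: D| < k.+1 ->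
  exists s t : 'I_n, s + t = k /\ (s, t) \notin D.
Proof.
move=> kn lt_diag.
have [/existsP[[s t] /andP[/eqP stk stD]]|/existsPn full] :=
    boolP [exists c : 'I_n * 'I_n, (c.1 + c.2 == k) && (c \notin D)].
  by exists s, t.
case/negP: (ltn_geF lt_diag).
have lts (t : 'I_k.+1) : t < n by apply: leq_trans (ltn_ord t) kn.
have ltk (t : 'I_k.+1) : k - t < n by apply: leq_ltn_trans (leq_subr _ _) kn.
pose f t : 'I_n * 'I_n := (Ordinal (lts t), Ordinal (ltk t)).
have f_inj : injective f by move=> t u [tu _]; apply: val_inj.
rewrite -[X in X <= _]card_ord -(card_imset _ f_inj); apply/subset_leq_card.
apply/subsetP => _ /imsetP[t _ ->].
have tk : t + (k - t) = k by rewrite subnKC // -ltnS.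
rewrite !inE /= addSn addnS tk eqxx /=.
by have := full (f t); rewrite /= tk eqxx negbK.
Qed.

Lemma card_ord_lt (s : 'I_n) : #|[set i : 'I_n | i < s]| = s.
Proof.
rewrite -sum1_card (eq_bigl (fun i : 'I_n => i < s)) => [|i]; last by rewrite inE.
by rewrite (big_ord_narrow (ltnW (ltn_ord s))) /= sum1_card card_ord.
Qed.

(** Take [k = 0] for the zero sequence and otherwise [k = r], the end of the staircase: the next
    term is at most [d_r = r], or the next diagonal is empty. *)
Lemma ferrers_seq_diagonal D d : 0 < n -> ferrers_seq d -> has_diagonals D d ->
  exists2 k, k <= maxdiag d & k < n -> #|diagonal n k.+1 :&: D| < k.+1.
Proof.
move=> n0 fd [hD1 hD0]; case: fd => [d0 | [r [/andP[r1 rd] dr dle]]].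
  exists 0 => // _; have [sd|sd] := leqP 1 (size d); last by rewrite hD0.
  by rewrite hD1 // d0.
have drr : term d r = r by rewrite dr // r1 leqnn.
exists r.
  rewrite -[X in X <= _]drr; apply: leq_bigmax_seq => //.
  by rewrite mem_nth // prednK.
move=> _; have [rsd|sdr] := ltnP r (size d); last by rewrite hD0.
by rewrite hD1 // ltnS -[X in _ <= X]drr dle // leqnn.
Qed.

(** If the cell [(s, t)] is missing, every cell of the diagram has row below [s] or column below
    [t]; these lines number [s + t = k]. *)
Lemma mxrank_diagram_leq (K : fieldType) D d (M : 'M[K]_n) : 0 < n ->
    ferrers_diagram D -> ferrers_seq d -> has_diagonals D d ->
    (forall i j, M i j != 0%R -> (i, j) \in D) ->
  \rank M <= maxdiag d.
Proof.
move=> n0 fD fd hD suM; have [k kd hk] := ferrers_seq_diagonal n0 fd hD.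
apply: leq_trans kd; have [kn|nk] := ltnP k n; last first.
  exact: leq_trans (rank_leq_row M) nk.
have [s [t [<- stD]]] := partial_diagonal kn (hk kn).
rewrite -(card_ord_lt s) -(card_ord_lt t).
apply: mxrank_cross_leq => i j /suM ijD; rewrite !inE.
apply: contraNT stD; rewrite negb_or -!leqNgt => /andP[si tj].
exact: fD ijD si tj.
Qed.

End Diagrams.

(** * Translation between diagrams and relations on indices *)

Section Transfer.
Variables (K : finFieldType) (n : nat) (D : {set 'I_n * 'I_n}).

Let e : rel 'I_n := fun i j => (i, j) \in D.

Lemma supported_setT (M : 'M[K]_n) :
  supported e setT M = (support_mx M \subset D).
Proof.
apply/supportedP/subsetP => [suM [i j] | suM i j nz].
  by rewrite inE => /suM[].
by rewrite !inE; split=> //; apply: suM; rewrite inE.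
Qed.

Lemma signed_symmetric (M : 'M[K]_n) : signed false M = symmetric_mx M.
Proof.
rewrite /signed andbT; apply: eq_forallb => i; apply: eq_forallb => j.
by rewrite mul1r.
Qed.

Lemma signed_alternating (M : 'M[K]_n) : signed true M = alternating_mx M.
Proof.
rewrite /signed andbC /alternating_mx; congr (_ && _).
by apply: eq_forallb => i; apply: eq_forallb => j; rewrite mulN1r.
Qed.

Lemma W_sym_signed r : W_sym K r D = #|signed_rank_set K e false setT r|.
Proof.
by apply: eq_card => M; rewrite !inE supported_setT signed_symmetric.
Qed.

Lemma W_alt_signed r : W_alt K r D = #|signed_rank_set K e true setT r|.
Proof.
by apply: eq_card => M; rewrite !inE supported_setT signed_alternating.
Qed.

Lemma card_main_diagonal : #|main_diagonal n :&: D| = diag_count e setT.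
Proof.
have diag_inj : injective (fun i : 'I_n => (i, i)) by move=> i j [].
rewrite /diag_count -(card_imset _ diag_inj); apply: eq_card => -[i j].
apply/idP/imsetP => [|[k + [-> ->]]]; last by rewrite !inE /= eqxx.
by rewrite !inE /= => /andP[/eqP <- iD]; exists i; rewrite ?inE.
Qed.

End Transfer.

Theorem theorem5p2 (q : nat) (K : finFieldType) (hq : #|K| = q)
  (n : nat) (hn : 0 < n)
  (d : seq nat)
  (hpos : (forall x, x \in d -> 0 < x) \/ (forall x, x \in d -> x = 0))
  (hd : sym_ferrers_seq d)
  (D : {set 'I_n * 'I_n})
  (hF : ferrers_diagram D) (hS : sym_diagram D) (hD : has_diagonals D d)
  (r : nat) (hr : r = maxdiag d) (hev : ~~ odd r) :
  q ^ #|main_diagonal n :&: D| * W_alt K r D = W_sym K r D.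
Proof.
rewrite W_sym_signed W_alt_signed card_main_diagonal -hq.
apply: card_alt_sym hev _ => [i j||M suM]; first by apply/idP/idP; apply: hS.
  exact: hF.
(* The Ferrers sequence enters through the rank bound. *)
rewrite hr; apply: mxrank_diagram_leq hn hF (proj1 hd) hD _.
by move=> i j /(supportedP _ _ _ suM)[].
Qed.
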